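(* For any graph $G$ with at least one edge, $d_0(G)=\operatorname{sep}(G)$.
   Context: All graphs are finite and simple. For a graph $G$, the $k$-dominating graph $D_k(G)$ has as vertices the dominating sets of $G$ of cardinality at most $k$, two such sets being adjacent if and only if one can be obtained from the other by adding or deleting a single vertex. $d_0(G)$ denotes the smallest integer such that $D_k(G)$ is connected for all $k\geq d_0(G)$. Let $\mathcal{D}(G)$ be the collection of all minimal dominating sets of $G$. For a partition $\Pi=\mathcal{X}\cup\mathcal{Y}$ of $\mathcal{D}(G)$ into two nonempty subcollections, $\operatorname{sep}(\Pi)=\min\{|X\cup Y|: X\in\mathcal{X}, Y\in\mathcal{Y}\}$, and $\operatorname{sep}(G)=\max\{\operatorname{sep}(\Pi)\}$, the maximum taken over all partitions $\Pi$ of $\mathcal{D}(G)$ into two nonempty subcollections. *)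

(* Defs.v *)
From mathcomp Require Import boolp.
From mathcomp Require Import all_boot.

Set Implicit Arguments.
Unset Strict Implicit.
Unset Printing Implicit Defensive.

Record sgraph := SGraph {
  vertex :> finType;
  adj : rel vertex;
  adj_sym : symmetric adj;
  adj_irrefl : irreflexive adj }.

(* The graph without vertices is not connected; hence D_k(G) is not connected
   for k below the domination number. *)
Definition connected (G : sgraph) : Prop :=
  (exists x : G, True) /\ (forall x y : G, connect (@adj G) x y).

Section Domination.

Variable G : sgraph.

Definition dominating (S : {set G}) : bool :=
  [forall v : G, (v \notin S) ==> [exists u in S, adj u v]].

Definition min_dominating_sets : {set {set G}} :=
  [set S | minset dominating S].

Definition add_or_delete (A B : {set G}) : bool :=
  [exists v : G, ((v \notin A) && (B == v |: A)) ||
                 ((v \in A) && (B == A :\ v))].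

Lemma add_or_delete_sym : symmetric add_or_delete.
Proof.
suff H A B : add_or_delete A B -> add_or_delete B A.
  by move=> A B; apply/idP/idP; apply: H.
case/existsP => v /orP [] /andP [vA /eqP ->];
  apply/existsP; exists v; apply/orP.
  by right; rewrite setU11 setU1K //= eqxx.
by left; rewrite setD11 setD1K //= eqxx.
Qed.

Lemma add_or_delete_irrefl : irreflexive add_or_delete.
Proof.
move=> A; apply/negbTE/negP => /existsP [v] /orP [] /andP [vA /eqP E].
  by move: vA; rewrite E setU11.
by move: vA; rewrite E setD11.
Qed.

Definition dom_vertex (k : nat) : finType :=
  {S : {set G} | dominating S && (#|S| <= k)}.

Definition dom_adj (k : nat) : rel (dom_vertex k) :=
  fun A B => add_or_delete (val A) (val B).

Lemma dom_adj_sym k : symmetric (@dom_adj k).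
Proof. by move=> A B; apply: add_or_delete_sym. Qed.

Lemma dom_adj_irrefl k : irreflexive (@dom_adj k).
Proof. by move=> A; apply: add_or_delete_irrefl. Qed.

Definition dominating_graph (k : nat) : sgraph :=
  SGraph (@dom_adj_sym k) (@dom_adj_irrefl k).

Definition connected_from (d : nat) : Prop :=
  forall k, d <= k -> connected (dominating_graph k).

Lemma dominatingS (A B : {set G}) : A \subset B -> dominating A -> dominating B.
Proof.
move=> sAB /forallP dA; apply/forallP => v; apply/implyP => vB.
have vA : v \notin A by apply: contra vB; apply: (subsetP sAB).
have /existsP [u /andP [uA uv]] := implyP (dA v) vA.
by apply/existsP; exists u; rewrite uv (subsetP sAB).
Qed.

Lemma connected_from_card : connected_from #|G|.
Proof.
move=> k le_k.
have okT : dominating [set: G] && (#|[set: G]| <= k).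
  by rewrite cardsT le_k andbT; apply/forallP => v; rewrite inE.
pose T : dominating_graph k := Sub [set: G] okT.
have toT n (A : dominating_graph k) :
    #|~: val A| <= n -> connect (@adj (dominating_graph k)) A T.
  elim: n A => [|n IHn] A.
    rewrite leqn0 cards_eq0 => /eqP E.
    suff -> : A = T by apply: connect0.
    by apply: val_inj; rewrite /= -[LHS]setCK E setC0.
  have [E _|[v vA] leA] := set_0Vmem (~: val A).
    by apply: IHn; rewrite E cards0.
  have okB : dominating (v |: val A) && (#|v |: val A| <= k).
    rewrite (leq_trans (max_card _) le_k) andbT.
    by have /andP [dA _] := valP A; apply: dominatingS dA; apply: subsetUr.
  pose B : dominating_graph k := Sub (v |: val A) okB.
  apply: (@connect_trans _ _ B).
    apply: connect1; apply/existsP; exists v; apply/orP; left.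
    by rewrite -in_setC vA /=.
  apply: IHn; rewrite -ltnS; apply: leq_trans leA.
  have -> : ~: val B = (~: val A) :\ v by rewrite /= setCU setDE setIC.
  by rewrite [leqRHS](cardsD1 v) vA.
split; first by exists T.
move=> A B; apply: (connect_trans (toT _ _ (leqnn _))).
rewrite (sym_connect_sym (@adj_sym _)); exact: toT (leqnn _).
Qed.

Lemma connected_from_ex : exists d, `[< connected_from d >].
Proof. by exists #|G|; apply/asboolP; apply: connected_from_card. Qed.

(* For negative k the graph D_k(G) would have no vertex, hence would not be
   connected, so the least integer is a least natural number. *)
Definition d0 : nat := ex_minn connected_from_ex.

Definition bipartition (X Y : {set {set G}}) : bool :=
  [&& X :|: Y == min_dominating_sets, [disjoint X & Y],
      X != set0 & Y != set0].

(* #|G| bounds every #|A :|: B|, so for nonempty X and Y this is the actual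
   minimum. *)
Definition sep_partition (X Y : {set {set G}}) : nat :=
  \big[minn/#|G|]_(A in X) \big[minn/#|G|]_(B in Y) #|A :|: B|.

(* As soon as G has an edge there are two minimal dominating sets, so that the
   maximum ranges over a nonempty family. *)
Definition sep : nat :=
  \max_(P : {set {set G}} * {set {set G}} | bipartition P.1 P.2)
    sep_partition P.1 P.2.

End Domination.

(* Main.v *)
(** Every dominating set of size at most [k] descends inside [D_k(G)] to a
minimal one, and two minimal sets with [|X :|: Y| <= k] are joined in [D_k(G)]
through their union.  Hence a component of [D_k(G)] with [k >= sep G] cannot
split the minimal dominating sets.  Conversely, for a bipartition of separation
[s > k], no vertex of [D_k(G)] contains minimal sets of both parts, so the part
is constant along paths; for [k = s - 1] both parts do occur in [D_k(G)], because
the two sets realising [s] are incomparable. *)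
Require Import Defs.
From mathcomp Require Import boolp.
From mathcomp Require Import all_boot.

Set Implicit Arguments.
Unset Strict Implicit.
Unset Printing Implicit Defensive.

(** * Minima over finite families, with a default value *)

Lemma bigminn_le (I : finType) (P : pred I) (F : I -> nat) m i :
  P i -> \big[minn/m]_(j | P j) F j <= F i.
Proof.
move=> Pi; have := mem_index_enum i; elim: (index_enum I) => // j r IHr.
rewrite inE big_cons => /predU1P [<-|/IHr leF]; first by rewrite Pi geq_minl.
by case: ifP => // _; apply: leq_trans (geq_minr _ _) leF.
Qed.

Lemma leq_bigminn (I : finType) (P : pred I) (F : I -> nat) m n :
  n <= m -> (forall i, P i -> n <= F i) -> n <= \big[minn/m]_(i | P i) F i.
Proof. by move=> nm nF; elim/big_ind: _ => // x y; rewrite leq_min => -> ->. Qed.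

Section Separation.

Variable G : sgraph.
Implicit Types (A B M N S : {set G}) (X Y : {set {set G}}) (k : nat).

Local Notation Dk := (dominating_graph G).

Lemma sep_partition_le X Y A B :
  A \in X -> B \in Y -> sep_partition X Y <= #|A :|: B|.
Proof.
move=> AX BY; rewrite /sep_partition.
by apply: leq_trans (bigminn_le _ _ AX) _; exact: bigminn_le.
Qed.

(** The bound [n <= #|G|] handles the default value of the iterated minimum. *)
Lemma leq_sep_partition X Y n : n <= #|G| ->
  (forall A B, A \in X -> B \in Y -> n <= #|A :|: B|) -> n <= sep_partition X Y.
Proof.
move=> nG nXY; apply: leq_bigminn => // A AX.
by apply: leq_bigminn => // B; apply: nXY.
Qed.

Lemma sep_partition_attained X Y : X != set0 -> Y != set0 ->
  exists A B, [/\ A \in X, B \in Y & sep_partition X Y = #|A :|: B|].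
Proof.
move=> /set0Pn [A0 A0X] /set0Pn [B0 B0Y].
pose P (p : {set G} * {set G}) := (p.1 \in X) && (p.2 \in Y).
have P0 : P (A0, B0) by rewrite /P A0X.
case: (arg_minnP (fun p => #|p.1 :|: p.2|) P0) => -[A B] /andP [AX BY] min_AB.
exists A, B; split=> //; apply/eqP; rewrite eqn_leq sep_partition_le //=.
(* The default [#|G|] cannot undercut the minimum, since no union exceeds the vertex set. *)
apply: leq_sep_partition => [|A' B' A'X B'Y]; first exact: max_card.
by apply: (min_AB (A', B')); rewrite /P A'X.
Qed.

(** * Minimal dominating sets *)

Lemma bipartition_mem X Y M : bipartition X Y ->
  (M \in min_dominating_sets G) = (M \in X) || (M \in Y).
Proof. by case/and4P=> /eqP <- _ _ _; rewrite inE. Qed.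

Lemma min_dominatingW M : M \in min_dominating_sets G -> dominating M.
Proof. by rewrite inE => /minsetp. Qed.

Lemma min_dominating_sub S : dominating S ->
  exists2 M, M \in min_dominating_sets G & M \subset S.
Proof. by case/minset_exists=> M minM sMS; exists M => //; rewrite inE. Qed.

(** If [N] were contained in [M], minimality of [M] would force equality. The strict inclusion later
    saves one unit of cardinality. *)
Lemma min_dominating_incomparable M N :
  M \in min_dominating_sets G -> N \in min_dominating_sets G ->
  M != N -> M \proper M :|: N.
Proof.
move=> minM minN neqMN; rewrite properE subsetUl subUset subxx /=.
apply: contra neqMN => sNM; apply/eqP/esym.
by move: minM; rewrite inE => /minsetinf; apply=> //; apply: min_dominatingW.
Qed.

(** Only [x] is left out, and its neighbour [y], distinct from [x] by irreflexivity, dominates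
    it. *)
Lemma dominating_setC1 (x y : G) : adj x y -> dominating [set~ x].
Proof.
move=> xy; apply/forallP => v; rewrite !inE negbK; apply/implyP => /eqP ->.
apply/existsP; exists y; rewrite !inE adj_sym xy andbT.
by apply: contraTneq xy => ->; rewrite adj_irrefl.
Qed.

(** If some [z] in [M] has a neighbour, a minimal set inside the complement of [z] differs from [M].
    Otherwise [M] has only isolated vertices and fails to dominate an end of an edge. As [M] is
    arbitrary, [set0] may be taken to get a minimal dominating set at all. *)
Lemma min_dominating_other M : (exists x y : G, adj x y) ->
  exists2 N, N \in min_dominating_sets G & N != M.
Proof.
move=> [x [y xy]].
have [[z [w [zw zM]]]|noM] := EM (exists z w : G, adj z w /\ z \in M).
  have [N minN sN] := min_dominating_sub (dominating_setC1 zw).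
  exists N => //; apply: contraTneq zM => <-; apply/negP => /(subsetP sN).
  by rewrite !inE eqxx.
have [N minN _] := min_dominating_sub (dominating_setC1 xy).
exists N => //; apply/eqP => eqNM; apply: noM.
have [xM|xM] := boolP (x \in M); first by exists x, y.
have /forallP/(_ x) := min_dominatingW minN; rewrite eqNM xM /=.
by case/existsP=> u /andP [uM ux]; exists u, x.
Qed.

(** Separate [M] from all other minimal dominating sets: each union then contains [M]. This makes
    every minimal dominating set a vertex of [Dk k] once [k] reaches [sep G]. *)
Lemma card_min_dominating_le_sep M : (exists x y : G, adj x y) ->
  M \in min_dominating_sets G -> #|M| <= sep G.
Proof.
move=> hG minM; have [N minN neqNM] := min_dominating_other M hG.
pose P := ([set M], min_dominating_sets G :\ M).
have bipP : bipartition P.1 P.2.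
  apply/and4P; split=> /=.
  - by rewrite setD1K.
  - by rewrite disjoints1 setD11.
  - by apply/set0Pn; exists M; rewrite set11.
  - by apply/set0Pn; exists N; rewrite in_setD1 neqNM.
apply: leq_trans (@leq_bigmax_cond _ _ _ P bipP) => /=.
apply: leq_sep_partition => [|A B /set1P -> _]; first exact: max_card.
exact/subset_leq_card/subsetUl.
Qed.

(** * Paths in the k-dominating graph *)

Lemma connect_subset k (S T : Dk k) :
  val S \subset val T -> connect (@adj (Dk k)) S T.
Proof.
have [n] := ubnP #|val T :\: val S|; elim: n S => // n IHn S leST sST.
have [/eqP eqST|[v vTS]] := set_0Vmem (val T :\: val S).
  suff -> : S = T by apply: connect0.
  by apply/val_inj/eqP; rewrite eqEsubset sST -setD_eq0.
have /setDP [vT vS] := vTS; have /andP [dS _] := valP S.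
have /andP [_ leTk] := valP T.
(* Adding one missing vertex stays between [S] and [T]: the set above [S] dominates, the set below
   [T] has size at most [k]. *)
have sUT : v |: val S \subset val T by rewrite subUset sub1set vT.
have okU : dominating (v |: val S) && (#|v |: val S| <= k).
  rewrite (dominatingS _ dS) ?subsetUr //.
  exact: leq_trans (subset_leq_card sUT) leTk.
pose U : Dk k := Sub (v |: val S) okU; apply: (@connect_trans _ _ U).
  by apply/connect1/existsP; exists v; rewrite vS /= eqxx.
apply: IHn => //=; rewrite -ltnS; apply: leq_trans leST.
rewrite ltnS [leqRHS](cardsD1 v) vTS; apply: subset_leq_card.
by apply/subsetP => u; rewrite !inE negb_or -andbA.
Qed.

Lemma dominating_connect_sym k (S T : Dk k) :
  connect (@adj (Dk k)) S T = connect (@adj (Dk k)) T S.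
Proof. exact/sym_connect_sym/adj_sym. Qed.

Lemma connect_union k (S T : Dk k) :
  #|val S :|: val T| <= k -> connect (@adj (Dk k)) S T.
Proof.
move=> leU; have /andP [dS _] := valP S.
have okU : dominating (val S :|: val T) && (#|val S :|: val T| <= k).
  by rewrite leU (dominatingS _ dS) ?subsetUl.
pose U : Dk k := Sub (val S :|: val T) okU.
apply: (@connect_trans _ _ U); last rewrite dominating_connect_sym.
  by apply: connect_subset; apply: subsetUl.
by apply: connect_subset; apply: subsetUr.
Qed.

Lemma min_dominating_connect k (S : Dk k) :
  exists2 M : Dk k, val M \in min_dominating_sets G & connect (@adj (Dk k)) S M.
Proof.
have /andP [dS leS] := valP S; have [M minM sMS] := min_dominating_sub dS.
have okM : dominating M && (#|M| <= k).
  by rewrite (min_dominatingW minM) (leq_trans (subset_leq_card sMS)).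
by exists (Sub M okM) => //; rewrite dominating_connect_sym; apply: connect_subset.
Qed.

(** * Upper bound: connectedness from [sep G] on *)

Lemma connected_from_sep : (exists x y : G, adj x y) -> connected_from G (sep G).
Proof.
move=> hG k le_k.
have okM M : M \in min_dominating_sets G -> dominating M && (#|M| <= k).
  move=> minM; rewrite min_dominatingW //=.
  exact: leq_trans (card_min_dominating_le_sep hG minM) le_k.
split=> [|S T].
  have [M minM _] := min_dominating_other set0 hG.
  by exists (Sub M (okM M minM)).
apply/negPn/negP => nST.
(* [X] gathers the minimal sets in the component of [S]. Descending from [S] and from [T] shows that
   both [X] and its complement [Y] are nonempty. *)
pose X := [set M in min_dominating_sets G |
  [exists A : Dk k, (val A == M) && connect (@adj (Dk k)) S A]].
pose Y := min_dominating_sets G :\: X.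
have inX (A : Dk k) : val A \in min_dominating_sets G ->
    (val A \in X) = connect (@adj (Dk k)) S A.
  move=> minA; rewrite inE minA; apply/existsP/idP => [[B]|cSA].
    by case/andP=> /eqP /val_inj ->.
  by exists A; rewrite eqxx.
have sXD : X \subset min_dominating_sets G.
  by apply/subsetP => M; rewrite inE => /andP [].
have X0 : X != set0.
  have [M minM cSM] := min_dominating_connect S.
  by apply/set0Pn; exists (val M); rewrite inX.
have Y0 : Y != set0.
  have [N minN cTN] := min_dominating_connect T.
  apply/set0Pn; exists (val N); rewrite in_setD minN andbT inX //.
  by apply: contra nST => /connect_trans; apply; rewrite dominating_connect_sym.
have bipXY : bipartition X Y.
  apply/and4P; split=> //; first by rewrite -{1}(setIidPr sXD) setID.
  by rewrite disjoint_sym disjoints_subset subsetDr.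
have [A [B [AX BY sepAB]]] := sep_partition_attained X0 Y0.
have minA := subsetP sXD A AX; have /setDP [minB BX] := BY.
(* A closest pair across the partition has union of size at most [sep G], so it is joined through
   that union, although [B] lies outside the component. *)
have leAB : #|A :|: B| <= k.
  rewrite -sepAB; apply: leq_trans le_k.
  exact: (@leq_bigmax_cond _ _ _ (X, Y) bipXY).
have cAB := @connect_union k (Sub A (okM A minA)) (Sub B (okM B minB)) leAB.
have := inX (Sub B (okM B minB)) minB; have := inX (Sub A (okM A minA)) minA.
rewrite /= AX (negPf BX) => /esym cSA /esym /negP; apply.
exact: connect_trans cSA cAB.
Qed.

(** * Lower bound: a bipartition obstructs connectedness *)

Lemma connect_same_part X Y k (S T : Dk k) :
    bipartition X Y -> k < sep_partition X Y -> connect (@adj (Dk k)) S T ->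
  [exists M in X, M \subset val S] = [exists M in X, M \subset val T].
Proof.
move=> bipXY ltk; pose a := [pred U : Dk k | [exists M in X, M \subset val U]].
have mono (U V : Dk k) : val U \subset val V -> (U \in a) = (V \in a).
  move=> sUV; apply/existsP/existsP => -[M /andP [MX sM]].
    by exists M; rewrite MX (subset_trans sM).
  (* A minimal set [N] inside [U] must lie in [X]: otherwise [V] would contain a member of each
     part, hence a union of size above [k]. *)
  have /andP [dU _] := valP U; have [N minN sNU] := min_dominating_sub dU.
  exists N; rewrite sNU andbT; move: minN.
  rewrite (bipartition_mem _ bipXY) => /orP [] // NY.
  have /andP [_ leVk] := valP V.
  have := leq_trans ltk (sep_partition_le MX NY); rewrite ltnNge.
  case/negP; apply: leq_trans leVk; apply: subset_leq_card.
  by rewrite subUset sM (subset_trans sNU).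
have cl : closed (@adj (Dk k)) a.
  move=> U V /existsP [v] /orP [] /andP [_ /eqP eqV].
    by apply: mono; rewrite eqV subsetUr.
  by apply/esym/mono; rewrite eqV subsetDl.
by move=> cST; apply: (closed_connect cl cST).
Qed.

Lemma sep_partition_connected_from X Y d :
  bipartition X Y -> connected_from G d -> sep_partition X Y <= d.
Proof.
move=> bipXY conn; rewrite leqNgt; apply/negP => ltd.
have /and4P [_ disXY X0 Y0] := bipXY.
have [A [B [AX BY sepAB]]] := sep_partition_attained X0 Y0.
have minA : A \in min_dominating_sets G by rewrite (bipartition_mem _ bipXY) AX.
have minB : B \in min_dominating_sets G.
  by rewrite (bipartition_mem _ bipXY) BY orbT.
have BX : B \notin X by rewrite (disjointFl disXY BY).
have neqAB : A != B by apply: contraNneq BX => <-.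
(* The largest [k] to which [connect_same_part] applies; it is still at least [d]. *)
pose k := (sep_partition X Y).-1.
have Sk : k.+1 = sep_partition X Y by apply: prednK; apply: leq_trans ltd.
have okA : dominating A && (#|A| <= k).
  rewrite min_dominatingW //= -ltnS Sk sepAB; apply: proper_card.
  exact: min_dominating_incomparable.
have okB : dominating B && (#|B| <= k).
  rewrite min_dominatingW //= -ltnS Sk sepAB setUC; apply: proper_card.
  by apply: min_dominating_incomparable => //; rewrite eq_sym.
have le_dk : d <= k by rewrite -ltnS Sk.
have [_ /(_ (Sub A okA) (Sub B okB)) cAB] := conn k le_dk.
have ltk : k < sep_partition X Y by rewrite Sk.
have := connect_same_part bipXY ltk cAB; rewrite /=.
have -> : [exists M in X, M \subset A] by apply/existsP; exists A; rewrite AX /=.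
(* A member of [X] inside [B] equals [B] by minimality, yet [B] is not in [X]. *)
move/esym/existsP=> [M /andP [MX sMB]]; move: BX; rewrite -(_ : M = B) ?MX //.
move: minB; rewrite inE => /minsetinf; apply=> //.
by apply: min_dominatingW; rewrite (bipartition_mem _ bipXY) MX.
Qed.

End Separation.

Theorem theorem5 (G : sgraph) (hG : exists x y : G, adj x y) : d0 G = sep G.
Proof.
rewrite /d0; case: ex_minnP => d /asboolP conn min_d; apply/eqP.
rewrite eqn_leq min_d; last by apply/asboolP; apply: connected_from_sep.
by apply/bigmax_leqP => P bipP; apply: sep_partition_connected_from.
Qed.
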